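(* Let $X$ be a (nonempty) compact Hausdorff $G$-space and let $f:X\rightarrow X$ be pseudoequivariant. Then $X$ contains a nonempty subset that is a $G$-minimal set of $f$ and is $f$-invariant. Also, any two distinct $G$-minimal sets of $f$ are disjoint.
   Context: A $G$-space $X$ is a topological space $X$ together with a topological group $G$ and a continuous action $G\times X\to X$, $(g,x)\mapsto g.x$. For $x\in X$, $G(x)=\{g.x:g\in G\}$. A map $f:X\to X$ is pseudoequivariant if it is continuous and $f(G(x))=G(f(x))$ for every $x\in X$. The $G_f$-orbit of $x$ is $G_f(x)=\{g.f^k(x):g\in G,\ k\geqslant 0\}$, where $f^k$ is the $k$-th iterate of $f$. A subset $A\subseteq X$ is $f$-invariant if $f(A)=A$, $+f$ invariant if $f(A)\subseteq A$, and $G$-invariant if $g.A\subseteq A$ for every $g\in G$. A nonempty, closed, $+f$ invariant, $G$-invariant subset $Y$ of $X$ is a $G$-minimal set of $f$ if $\overline{G_f(y)}=Y$ for every $y\in Y$. *)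

(* Defs.v *)
From HB Require Import structures.
From mathcomp Require Import all_boot.
From mathcomp Require Import all_classical topology.

Set Implicit Arguments.
Unset Strict Implicit.
Unset Printing Implicit Defensive.

Local Open Scope classical_set_scope.

HB.structure Definition PreTopologicalGroup :=
  {G of Topological G & Group G}.

(* Multiplicative, possibly non-abelian counterpart of TopologicalZmodule;
   no separation axiom is imposed on G. *)
HB.mixin Record PreTopologicalGroup_isTopologicalGroup G
    & PreTopologicalGroup G := {
  mulg_continuous : continuous (fun x : G * G => (x.1 * x.2)%g) ;
  invg_continuous : continuous (fun x : G => (x^-1)%g)
}.

#[short(type="topologicalGroupType")]
HB.structure Definition TopologicalGroup :=
  {G of PreTopologicalGroup G & PreTopologicalGroup_isTopologicalGroup G}.

(* Jointly continuous left actions; finite group actions in fingroup are right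
   actions of finite groups, hence not usable here. *)
Record gspace (G : topologicalGroupType) (X : topologicalType) := GSpace {
  gact :> G -> X -> X ;
  gact1 : forall x, gact 1%g x = x ;
  gactM : forall g h x, gact (g * h)%g x = gact g (gact h x) ;
  gact_continuous : continuous (fun p : G * X => gact p.1 p.2)
}.

Section GSpaceDefs.
Variables (G : topologicalGroupType) (X : topologicalType) (act : gspace G X).
Implicit Types (f : X -> X) (x : X) (A Y : set X).

Definition Gorbit x : set X := [set act g x | g in [set: G]].

Definition pseudoequivariant f : Prop :=
  continuous f /\ forall x, f @` Gorbit x = Gorbit (f x).

Definition Gf_orbit f x : set X :=
  [set y | exists (g : G) (k : nat), y = act g (iter k f x)].

Definition f_invariant f A : Prop := f @` A = A.

Definition posf_invariant f A : Prop := f @` A `<=` A.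

Definition G_invariant A : Prop := forall g : G, act g @` A `<=` A.

Definition G_minimal f Y : Prop :=
  [/\ Y !=set0, closed Y, posf_invariant f Y, G_invariant Y
    & forall y, Y y -> closure (Gf_orbit f y) = Y].

End GSpaceDefs.

(* Main.v *)
(** By compactness and Zorn's lemma, there is a minimal element Y among the
    nonempty closed +f invariant G-invariant sets. Orbit closures in Y and the
    image f(Y) are again of this kind (the latter is closed because X is
    Hausdorff, and G-invariant because G(f(y)) = f(G(y))), so both equal Y. *)
Require Import Defs.
From HB Require Import structures.
From mathcomp Require Import all_boot.
From mathcomp Require Import all_classical topology.

Local Open Scope classical_set_scope.

(** A nonempty chain [D] is a base of a proper filter, and a cluster point of this filter lies in
    the closure of each member of [D], hence in the member itself. If [D] is empty the intersection
    is all of [X], so a point of [X] is required. *)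
Lemma compact_bigcap_chain (X : topologicalType) (D : set (set X)) :
  compact [set: X] -> [set: X] !=set0 ->
  (forall A, D A -> closed A /\ A !=set0) ->
  total_on D (fun A B => A `<=` B) ->
  \bigcap_(A in D) A !=set0.
Proof.
move=> Xc [x0 _] Dcl Dtot.
have [D0|/set0P [A0 DA0]] := eqVneq D set0.
  by exists x0; rewrite D0 bigcap_set0.
have FF : ProperFilter (filter_from D id).
  apply: filter_from_proper; last by move=> A /Dcl[].
  apply: filter_from_filter; first by exists A0.
  move=> A B DA DB; have [AB|BA] := Dtot _ _ DA DB.
    by exists A => // x Ax; split=> //; exact: AB.
  by exists B => // x Bx; split=> //; exact: BA.
have [|p [_ clp]] := Xc _ FF; first by exists A0.
exists p => A DA; apply: (Dcl _ DA).1 => U Up.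
by apply: clp Up; exists A.
Qed.

Section MinimalSets.
Variables (G : topologicalGroupType) (X : topologicalType) (act : gspace G X).
Variable f : X -> X.

(** The conditions of [G_minimal] other than the one on orbit closures; these sets form the family
    ordered by inclusion for Zorn's lemma. *)
Definition closed_invariant (Y : set X) : Prop :=
  [/\ Y !=set0, closed Y, posf_invariant f Y & G_invariant act Y].

Lemma closed_invariant_minimal_exists :
  compact [set: X] -> [set: X] !=set0 ->
  exists2 Y, closed_invariant Y &
    forall Z, closed_invariant Z -> Z `<=` Y -> Z = Y.
Proof.
move=> Xc X0.
have [|A [PA Amax]] := @Zorn_bigcup X [set A | closed_invariant (~` A)].
  move=> F FP Ftot /=; rewrite setC_bigcup; split.
  - rewrite -(bigcap_image F (@setC X) id).
    apply: compact_bigcap_chain => //.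
      by move=> _ [A FA <-]; have [] := FP _ FA.
    move=> _ _ [A FA <-] [B FB <-].
    by have [AB|BA] := Ftot _ _ FA FB; [right|left]; exact: subsetC.
  - by apply: closed_bigI => A FA; have [] := FP _ FA.
  - move=> _ [x Fx <-] A FA; have [_ _ + _] := FP _ FA; apply.
    by exists x => //; exact: Fx.
  - move=> g _ [x Fx <-] A FA; have [_ _ _ +] := FP _ FA; apply.
    by exists x => //; exact: Fx.
exists (~` A) => // Z CZ ZA; apply/seteqP; split=> //.
(* If [Z] were strictly smaller than [~] A[, then]~[Z] would strictly contain [A], against
   maximality. *)
apply: contrapT => nAZ; apply: (Amax (~` Z)); last by rewrite /= setCK.
split; first by rewrite -[A]setCK; exact: subsetC.
by move=> ZCA; apply: nAZ; rewrite -[Z]setCK; exact: subsetC.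
Qed.

Lemma Gf_orbit_subset (Y : set X) x : posf_invariant f Y ->
  G_invariant act Y -> Y x -> Gf_orbit act f x `<=` Y.
Proof.
move=> fY GY Yx _ [g [k ->]]; apply: (GY g); exists (iter k f x) => //.
by elim: k => //= k IH; apply: fY; exists (iter k f x).
Qed.

(** Used with [h] equal to [f] and to each translation [act g]. *)
Lemma image_closure_subset (h : X -> X) (A : set X) :
  continuous h -> h @` A `<=` A -> h @` closure A `<=` closure A.
Proof.
move=> hc hA _ [x clx <-] U /hc/clx [y [Ay Uy]].
by exists (h y); split=> //; apply: hA; exists y.
Qed.

Lemma gact_continuousr g : continuous (act g).
Proof.
move=> x; apply: (@continuous_comp _ _ _ (pair g) (fun p => act p.1 p.2)).
  by apply: cvg_pair; [exact: cvg_cst|exact: cvg_id].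
exact: gact_continuous.
Qed.

Hypothesis f_pseudo : pseudoequivariant act f.

Lemma closed_invariant_orbit_closure x :
  closed_invariant (closure (Gf_orbit act f x)).
Proof.
have [fc fG] := f_pseudo; split.
- by exists x; apply: subset_closure; exists 1%g, 0; rewrite gact1.
- exact: closed_closure.
- apply: image_closure_subset => // _ [_ [g [k ->]] <-].
  (* [f] need not commute with the action: $f(g.f^k(x))$ lies in $f(G(f^k(x))) = G(f^{k+1}(x))$, so
     it equals $h.f^{k+1}(x)$ for some [h], possibly other than [g]. *)
  have : (f @` Gorbit act (iter k f x)) (f (act g (iter k f x))).
    by exists (act g (iter k f x)) => //; exists g.
  by rewrite fG => -[h _ <-]; exists h, k.+1.
- move=> g; apply: image_closure_subset; first exact: gact_continuousr.
  by move=> _ [_ [h [k ->]] <-]; exists (g * h)%g, k; rewrite gactM.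
Qed.

Lemma closed_invariant_image (Y : set X) :
  compact [set: X] -> hausdorff_space X ->
  closed_invariant Y -> closed_invariant (f @` Y).
Proof.
move=> Xc XH [[y Yy] Ycl fY GY]; have [fc fG] := f_pseudo; split.
- by exists (f y), y.
- apply: compact_closed => //; apply: continuous_compact.
    exact: continuous_subspaceT.
  exact: (subclosed_compact Ycl Xc).
- exact: image_subset.
- move=> g _ [_ [x Yx <-] <-].
  (* The other inclusion of pseudoequivariance: $g.f(x) \in G(f(x)) = f(G(x))$, so $g.f(x) = f(h.x)$
     with $h.x \in Y$. *)
  have : Gorbit act (f x) (act g (f x)) by exists g.
  rewrite -fG => -[_ [h _ <-] <-].
  by exists (act h x) => //; apply: (GY h); exists x.
Qed.

End MinimalSets.

Theorem proposition3p10 (G : topologicalGroupType) (X : topologicalType)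
    (act : gspace G X) (f : X -> X)
    (X_nonempty : [set: X] !=set0) (X_compact : compact [set: X])
    (X_hausdorff : hausdorff_space X) (f_pseudo : pseudoequivariant act f) :
  (exists Y : set X, [/\ Y !=set0, G_minimal act f Y & f_invariant f Y]) /\
  (forall Y1 Y2 : set X, G_minimal act f Y1 -> G_minimal act f Y2 ->
    Y1 <> Y2 -> Y1 `&` Y2 = set0).
Proof.
split; last first.
  (* The orbit closure of a common point would equal both [Y1] and [Y2]. *)
  move=> Y1 Y2 [_ _ _ _ min1] [_ _ _ _ min2] Y12.
  by apply/seteqP; split=> // x [/min1 e1 /min2 e2]; apply: Y12; rewrite -e1.
have [Y CY Ymin] :=
  @closed_invariant_minimal_exists G X act f X_compact X_nonempty.
have [Y0 Ycl fY GY] := CY.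
exists Y; split=> //; last by apply: Ymin => //; exact: closed_invariant_image.
split=> // y Yy; apply: Ymin; first exact: closed_invariant_orbit_closure.
rewrite [X in _ `<=` X](closure_id Y).1 //; apply: closure_subset.
exact: Gf_orbit_subset.
Qed.
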